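(* Let $M,N\in\mathcal{GPG}$ be such that $\operatorname{ord}^*(M)\ge\operatorname{ord}^*(N)$ and $(\operatorname{ord}^*(M),\operatorname{ord}^*(N))\ne(1,0)$. Moreover, let $K\colon\mathbb{R}_+^2\to\mathbb{R}_+$ be the (uniquely determined) $(M,N)$-invariant mean. Then $K\in\mathcal{GPG}$ and $$\operatorname{ord}^*(K)=\frac{\operatorname{ord}^*(N)}{1-\operatorname{ord}^*(M)+\operatorname{ord}^*(N)}.$$
   Context: $\mathbb{R}_+:=(0,\infty)$. A (bivariate) mean is an arbitrary function $M\colon\mathbb{R}_+\times\mathbb{R}_+\to\mathbb{R}_+$ with $\min(x,y)\le M(x,y)\le\max(x,y)$ for all $x,y\in\mathbb{R}_+$. It is symmetric if $M(x,y)=M(y,x)$ for all $x,y\in\mathbb{R}_+$, and homogeneous if $M(tx,ty)=tM(x,y)$ for all $x,y,t\in\mathbb{R}_+$. $\mathcal{HS}$ denotes the family of all homogeneous, symmetric means $M\colon\mathbb{R}_+^2\to\mathbb{R}_+$. For $M\in\mathcal{HS}$ the lower order and upper order are the real numbers $$\operatorname{lord}(M):=\sup\Big\{\alpha\in\mathbb{R}\colon \limsup_{x\to0^+}\frac{M(x,1)}{x^\alpha}=0\Big\},\qquad \operatorname{uord}(M):=\inf\Big\{\alpha\in\mathbb{R}\colon \liminf_{x\to0^+}\frac{M(x,1)}{x^\alpha}=\infty\Big\}.$$ A mean $M\in\mathcal{HS}$ is of generalized power growth if $\operatorname{lord}(M)=\operatorname{uord}(M)$; $\mathcal{GPG}$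 denotes the class of all such means, and for $M\in\mathcal{GPG}$ one sets $\operatorname{ord}^*(M):=\operatorname{lord}(M)=\operatorname{uord}(M)$. A mean $K$ is $(M,N)$-invariant if $K\big(M(x,y),N(x,y)\big)=K(x,y)$ for all $x,y\in\mathbb{R}_+$. When $M,N\in\mathcal{HS}$ and the $(M,N)$-invariant mean $K$ is uniquely determined, $K$ also belongs to $\mathcal{HS}$. *)

(* Defs.v *)
From mathcomp Require Import all_boot all_order all_algebra.
From mathcomp Require Import all_classical all_reals all_analysis.
Import Order.TTheory GRing.Theory Num.Theory.
Import numFieldNormedType.Exports.

Set Implicit Arguments.
Unset Strict Implicit.
Unset Printing Implicit Defensive.

Local Open Scope classical_set_scope.
Local Open Scope ring_scope.

(* A function ]0, +oo[^2 -> R is represented by a total function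
   R -> R -> R whose values outside the open positive quadrant are ignored:
   every condition below is relativized to positive arguments. *)

(* The lower bound by the minimum makes the values positive. *)
Definition is_mean (R : realType) (M : R -> R -> R) : Prop :=
  forall x y : R, 0 < x -> 0 < y ->
    Num.min x y <= M x y /\ M x y <= Num.max x y.

Definition symmetric_mean (R : realType) (M : R -> R -> R) : Prop :=
  forall x y : R, 0 < x -> 0 < y -> M x y = M y x.

Definition homogeneous_mean (R : realType) (M : R -> R -> R) : Prop :=
  forall x y t : R, 0 < x -> 0 < y -> 0 < t -> M (t * x) (t * y) = t * M x y.

Definition HS (R : realType) (M : R -> R -> R) : Prop :=
  [/\ is_mean M, symmetric_mean M & homogeneous_mean M].

(* For a mean M, the two sets below are nonempty and bounded on the relevant
   side (x <= M x 1 <= 1 for 0 < x <= 1), so sup and inf are the real ones. *)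
Definition lord (R : realType) (M : R -> R -> R) : R :=
  sup [set alpha : R |
    limf_esup (fun x : R => (M x 1 / x `^ alpha)%:E) 0^'+ = 0%E].

Definition uord (R : realType) (M : R -> R -> R) : R :=
  inf [set alpha : R |
    limf_einf (fun x : R => (M x 1 / x `^ alpha)%:E) 0^'+ = +oo%E].

Definition GPG (R : realType) (M : R -> R -> R) : Prop :=
  HS M /\ lord M = uord M.

(* Meaningful when GPG M holds, in which case it is also uord M. *)
Definition ordstar (R : realType) (M : R -> R -> R) : R := lord M.

Definition invariant (R : realType) (M N K : R -> R -> R) : Prop :=
  forall x y : R, 0 < x -> 0 < y -> K (M x y) (N x y) = K x y.

Definition invariant_mean (R : realType) (M N K : R -> R -> R) : Prop :=
  is_mean K /\ invariant M N K.

(* Uniqueness is among all means, as functions on the positive quadrant. *)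
Definition unique_invariant_mean (R : realType) (M N K : R -> R -> R) : Prop :=
  invariant_mean M N K /\
  forall L : R -> R -> R, invariant_mean M N L ->
    forall x y : R, 0 < x -> 0 < y -> L x y = K x y.

(* Main.v *)
(** On the logarithmic scale a mean [M] becomes [phi_M s = - ln (M (e^-s, 1))],
    which lies between [0] and [s], and [M] has generalized order [k] iff
    [phi_M s = k s + o(s)].  By homogeneity and symmetry the invariance of [K]
    reads [phi_K = min (phi_M, phi_N) + phi_K |phi_M - phi_N|].  With orders
    [p >= q] of [M] and [N], a linear lower or upper bound for [phi_K] of slope
    [b] therefore yields one of slope [q + b (p - q)], up to an arbitrarily
    small error.  As [p - q < 1], this affine map is a contraction, and its
    fixed point [q / (1 - p + q)] is both the best lower and the best upper
    slope. *)

Require Import Defs.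
From mathcomp Require Import all_boot all_order all_algebra.
From mathcomp Require Import all_classical all_reals all_analysis.
From mathcomp Require Import ring lra.
Import Order.TTheory GRing.Theory Num.Theory.
Import numFieldNormedType.Exports.

Local Open Scope classical_set_scope.
Local Open Scope ring_scope.

(** * Upper and lower limits at [0^'+] as eventual bounds *)

Lemma limf_esup_eq0 (R : realType) (F : set_system R) (FF : ProperFilter F)
    (f : R -> R) : (\forall x \near F, 0 <= f x) ->
  limf_esup (fun x => (f x)%:E) F = 0%E <->
  (forall e, 0 < e -> \forall x \near F, f x <= e).
Proof.
move=> f0; split.
  rewrite limf_esupE => Hl e e0.
  have : (ereal_inf [set ereal_sup [set (f x)%:E | x in V] | V in F]
    < e%:E)%E by rewrite Hl lte_fin.
  move=> /ereal_inf_lt [_ [V FV <-]] Ve.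
  apply: filterS FV => x Vx; rewrite -lee_fin.
  apply: le_trans (ltW Ve); apply: ereal_sup_ubound.
  by exists x.
move=> He; rewrite limf_esupE; apply/eqP; rewrite eq_le; apply/andP; split.
  apply/lee_addgt0Pr => e e0; rewrite add0e.
  apply: (@le_trans _ _ (ereal_sup [set (f x)%:E | x in [set x | f x <= e]])).
    apply: ereal_inf_lbound; exists [set x | f x <= e] => //.
    exact: He.
  by apply: ge_ereal_sup => _ [x /= fe <-]; rewrite lee_fin.
apply: le_ereal_inf_tmp => _ [V FV <-].
(* By properness every [V] in [F] meets the set where [f] is nonnegative, so each supremum is at
   least [0]. *)
have [x [Vx fx]] := filter_ex (filterI FV f0).
apply: (@le_trans _ _ (f x)%:E); first by rewrite lee_fin.
by apply: ereal_sup_ubound; exists x.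
Qed.

Lemma limf_einf_eqy (R : realType) (F : set_system R) (FF : Filter F)
    (f : R -> R) :
  limf_einf (fun x => (f x)%:E) F = +oo%E <->
  (forall A, \forall x \near F, A <= f x).
Proof.
rewrite limf_einfE; split.
  move=> Hl A.
  have : (A%:E < ereal_sup [set ereal_inf [set (f x)%:E | x in V] | V in F])%E
    by rewrite Hl ltry.
  move=> /ereal_sup_gt [_ [V FV <-]] Ve.
  apply: filterS FV => x Vx; rewrite -lee_fin.
  apply: le_trans (ltW Ve) _; apply: ereal_inf_lbound.
  by exists x.
move=> HA; apply/eqyP => A A0.
apply: (@le_trans _ _ (ereal_inf [set (f x)%:E | x in [set x | A <= f x]])).
  by apply: le_ereal_inf_tmp => _ [x /= fe <-]; rewrite lee_fin.
apply: ereal_sup_ubound; exists [set x | A <= f x] => //.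
exact: HA.
Qed.

Lemma near_0right_expRN (R : realType) (P : R -> Prop) :
  (\forall x \near 0^'+, P x) <->
  exists S, forall s, S <= s -> P (expR (- s)).
Proof.
split.
  (* The extra [1] gives the strict inequality [expR (- s) < e] of the open ball. *)
  move=> [e /= e0 He]; exists (1 - ln e) => s hs.
  apply: He; last exact: expR_gt0.
  rewrite /ball_ /= sub0r normrN gtr0_norm ?expR_gt0//.
  rewrite -[ltRHS](lnK (e0 : e \is Num.pos)) ltr_expR; lra.
move=> [S HS]; exists (expR (- S)) => /=; first exact: expR_gt0.
move=> x /=; rewrite sub0r normrN => xS x0.
rewrite gtr0_norm// in xS.
have xpos : x \is Num.pos by [].
rewrite -(lnK xpos) -[ln x]opprK; apply: HS.
by rewrite lerNr -ler_expR lnK// ltW.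
Qed.

(** * Means on the logarithmic scale *)

Definition neglog {R : realType} (M : R -> R -> R) (s : R) : R :=
  - ln (M (expR (- s)) 1).

Lemma mean_gt0 {R : realType} {M : R -> R -> R} : is_mean M ->
  forall x y, 0 < x -> 0 < y -> 0 < M x y.
Proof.
move=> hM x y x0 y0; have [h _] := hM x y x0 y0.
by apply: lt_le_trans h; rewrite lt_min x0.
Qed.

Lemma expRN_neglog {R : realType} {M : R -> R -> R} : is_mean M ->
  forall s, M (expR (- s)) 1 = expR (- neglog M s).
Proof.
move=> hM s; rewrite opprK lnK// posrE.
exact: mean_gt0 hM _ _ (expR_gt0 _) ltr01.
Qed.

Lemma neglog_bounds {R : realType} {M : R -> R -> R} : is_mean M ->
  forall s, 0 <= s -> 0 <= neglog M s <= s.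
Proof.
move=> hM s s0; have [] := hM _ _ (expR_gt0 (- s)) ltr01.
rewrite (expRN_neglog hM).
have e1 : expR (- s) <= 1 by rewrite -expR0 ler_expR oppr_le0.
rewrite min_l// max_r// ler_expR lerN2 => ->.
by rewrite -expR0 ler_expR oppr_le0 => ->.
Qed.

Lemma mean_ratio {R : realType} {M : R -> R -> R} : is_mean M ->
  forall a s, M (expR (- s)) 1 / expR (- s) `^ a
              = expR (a * s - neglog M s).
Proof.
move=> hM a s; rewrite (expRN_neglog hM) -expRM -expRN -expRD.
by congr expR; ring.
Qed.

(** This is the condition that [M x 1 / x^a] tends to [0], read through [x = e^-s]. Applied to
    [- phi] it encodes, up to sign, the set that defines [uord]. *)
Definition dominated_slopes {R : realType} (phi : R -> R) : set R :=
  [set a | forall A, exists S, forall s, S <= s -> A <= phi s - a * s].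

Lemma lordE (R : realType) (M : R -> R -> R) : is_mean M ->
  lord M = sup (dominated_slopes (neglog M)).
Proof.
move=> hM; rewrite /lord; congr sup; apply/seteqP; split => a /=.
  rewrite limf_esup_eq0; last first.
    apply/near_0right_expRN; exists 0 => s _.
    by rewrite (mean_ratio hM) expR_ge0.
  move=> H A; have /near_0right_expRN [S HS] := H _ (expR_gt0 (- A)).
  exists S => s /HS; rewrite (mean_ratio hM) ler_expR; lra.
move=> H; rewrite limf_esup_eq0; last first.
  apply/near_0right_expRN; exists 0 => s _.
  by rewrite (mean_ratio hM) expR_ge0.
move=> e e0; apply/near_0right_expRN; have [S HS] := H (- ln e).
exists S => s /HS h; rewrite (mean_ratio hM).
by rewrite -[leRHS](lnK (e0 : e \is Num.pos)) ler_expR; lra.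
Qed.

Lemma uordE (R : realType) (M : R -> R -> R) : is_mean M ->
  uord M = - sup (dominated_slopes (fun s => - neglog M s)).
Proof.
move=> hM; rewrite /uord /inf; congr (- sup _); apply/seteqP; split => a /=.
  move=> [b /limf_einf_eqy H <-] A.
  have /near_0right_expRN [S HS] := H (expR A).
  exists S => s /HS; rewrite (mean_ratio hM) ler_expR; lra.
move=> H; exists (- a); last by rewrite opprK.
apply/limf_einf_eqy => A; apply/near_0right_expRN.
have [S HS] := H A; exists S => s /HS h; rewrite (mean_ratio hM).
(* The bound [1 + t <= expR t] treats [A] of any sign alike. *)
apply: le_trans (expR_ge1Dx _); lra.
Qed.

(** * Linear growth and its slope *)

(** The bound holds for all [s >= 0] up to a constant, not just eventually: the recursion evaluates
    it at [|mu s - nu s|], which may stay small. *)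
Definition growth_ge {R : realType} (phi : R -> R) (k : R) : Prop :=
  forall a, a < k -> exists C, forall s, 0 <= s -> a * s - C <= phi s.

Definition growth {R : realType} (phi : R -> R) (k : R) : Prop :=
  growth_ge phi k /\ growth_ge (fun s => - phi s) (- k).

Lemma linear_bounded_le0 (R : realType) (c C : R) :
  (forall s, 0 <= s -> c * s <= C) -> c <= 0.
Proof.
move=> H; case: (leP c 0) => // c0; have := H ((`|C| + 1) / c).
have := ler_norm C; have := normr_ge0 C => h1 h2.
rewrite [c * _]mulrC mulfVK ?gt_eqF// => H'.
suff : `|C| + 1 <= C by lra.
by apply: H'; apply: divr_ge0; lra.
Qed.

Lemma dominated_slopes_nonempty (R : realType) (phi : R -> R) :
  (forall s, 0 <= s -> `|phi s| <= s) -> (dominated_slopes phi !=set0).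
Proof.
(* Since [phi s >= - s], slope [-2] leaves a difference of at least [s]. *)
move=> hphi; exists (- 2) => A; exists `|A| => s As.
have := hphi s (le_trans (normr_ge0 _) As); rewrite ler_norml => /andP[h _].
have := ler_norm A; lra.
Qed.

Lemma growth_ge_sup (R : realType) (phi : R -> R) :
  (forall s, 0 <= s -> `|phi s| <= s) ->
  growth_ge phi (sup (dominated_slopes phi)).
Proof.
move=> hphi a /(sup_gt (dominated_slopes_nonempty _ _ hphi)) [b Hb ab].
have [S HS] := Hb 0.
(* Below [S], where the dominated slope says nothing, this constant absorbs
   [a * s - phi s <= (1 + |a|) * s]. *)
exists (`|S| * (1 + `|a|)) => s s0.
have S0 := normr_ge0 S; have a0 := normr_ge0 a; have aa := ler_norm a.
case: (leP S s) => [/HS h|sS].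
  have : 0 <= (b - a) * s by apply: mulr_ge0 => //; lra.
  have : 0 <= `|S| * (1 + `|a|) by apply: mulr_ge0 => //; lra.
  lra.
have := hphi s s0; rewrite ler_norml => /andP[h _].
have SS := ler_norm S.
have : 0 <= (`|S| - s) * (1 + `|a|) by apply: mulr_ge0; lra.
have : 0 <= (`|a| - a) * s by apply: mulr_ge0; lra.
lra.
Qed.

Lemma sup_dominated_slopes (R : realType) (phi : R -> R) (k : R) :
  growth phi k -> sup (dominated_slopes phi) = k.
Proof.
move=> [hl hu].
have ub : ubound (dominated_slopes phi) k.
  move=> a Ha; case: (leP a k) => // ka.
  (* An upper bound of midpoint slope, set against the dominated slope [a], would keep
     [(a - k) / 2 * s] bounded. *)
  have [|C HC] := hu (- ((a + k) / 2)); first lra.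
  have [S HS] := Ha (C + 1).
  have : (a - k) / 2 <= 0.
    apply: (@linear_bounded_le0 _ _ ((a - k) / 2 * `|S|)) => s s0.
    rewrite ler_wpM2l//; first lra.
    case: (leP S s) => [Ss|/ltW/le_trans]; last by apply; exact: ler_norm.
    have := HS s Ss; have := HC s s0.
    have : 0 <= (a - k) / 2 * s by apply: mulr_ge0 => //; lra.
    lra.
  lra.
have lb a : a < k -> dominated_slopes phi a.
  move=> ak A; have [|C HC] := hl ((a + k) / 2); first lra.
  (* From here on the gap between [a] and the midpoint slope contributes at least [|A + C|]. *)
  exists (`|A + C| / ((k - a) / 2)) => s hs.
  have d0 : 0 < (k - a) / 2 by lra.
  rewrite ler_pdivrMr// in hs.
  have s0 : 0 <= s.
    by rewrite -(pmulr_lge0 _ d0) (le_trans (normr_ge0 _) hs).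
  have := HC s s0; have := ler_norm (A + C); lra.
apply/eqP; rewrite eq_le; apply/andP; split.
  by apply: ge_sup => //; exists (k - 1); apply: lb; lra.
case: (leP k (sup _)) => // sk.
suff : (sup (dominated_slopes phi) + k) / 2 <= sup (dominated_slopes phi) by lra.
by apply: ub_le_sup; [exists k | apply: lb; lra].
Qed.

Lemma growthP (R : realType) (phi : R -> R) (k : R) : growth phi k ->
  forall e, 0 < e -> exists C, forall s, 0 <= s -> `|phi s - k * s| <= e * s + C.
Proof.
move=> [hl hu] e e0.
have [|C1 H1] := hl (k - e); first lra.
have [|C2 H2] := hu (- k - e); first lra.
exists (`|C1| + `|C2|) => s s0; rewrite ler_norml.
have := H1 s s0; have := H2 s s0; have := ler_norm C1; have := ler_norm C2.
have := normr_ge0 C1; have := normr_ge0 C2 => *.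
by apply/andP; split; lra.
Qed.

Lemma growth_itv (R : realType) (phi : R -> R) (k : R) :
  (forall s, 0 <= s -> 0 <= phi s <= s) -> growth phi k -> 0 <= k <= 1.
Proof.
move=> hphi /growthP H; apply/andP; split; case: leP => // hk.
  have [|C HC] := H (- k / 2); first lra.
  suff : - k / 2 <= 0 by lra.
  apply: (@linear_bounded_le0 _ _ C) => s s0.
  have := HC s s0; rewrite ler_norml => /andP[_ h].
  by have /andP[] := hphi s s0; lra.
have [|C HC] := H ((k - 1) / 2); first lra.
suff : (k - 1) / 2 <= 0 by lra.
apply: (@linear_bounded_le0 _ _ C) => s s0.
have := HC s s0; rewrite ler_norml => /andP[h _].
by have /andP[] := hphi s s0; lra.
Qed.

(** * The contraction of slopes *)

(* [S] is the set of nonnegative slopes of linear lower bounds; [Sstep] is the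
   contraction, and [d] measures how far [sup S] would lie below its fixed
   point. *)
Lemma growth_recursion_ge (R : realType) (phi mu nu : R -> R) (p q : R) :
  (forall s, 0 <= s -> 0 <= phi s <= s) ->
  (forall s, 0 <= s ->
    phi s = Num.min (mu s) (nu s) + phi `|mu s - nu s|) ->
  growth mu p -> growth nu q -> p <= 1 -> 0 <= q -> q <= p -> 0 < 1 - p + q ->
  growth_ge phi (q / (1 - p + q)).
Proof.
move=> hphi rec gmu gnu p1 q0 qp pq.
pose S := [set b | 0 <= b /\ exists C, forall s, 0 <= s -> b * s - C <= phi s].
have S0 : S 0.
  split=> //; exists 0 => s s0; have /andP[] := hphi s s0; lra.
have Sub : ubound S 1.
  move=> b [b0 [C HC]]; suff : b - 1 <= 0 by lra.
  apply: (@linear_bounded_le0 _ _ C) => s s0; have := HC s s0.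
  have /andP[] := hphi s s0; lra.
have Sstep b e : S b -> 0 < e -> 0 <= q - e + b * (p - q - 2 * e) ->
    S (q - e + b * (p - q - 2 * e)).
  move=> [b0 [C HC]] e0 T0; split=> //.
  have [C1 H1] := growthP _ _ _ gmu e e0.
  have [C2 H2] := growthP _ _ _ gnu e e0.
  exists (`|C1| + `|C2| + b * (C1 + C2) + C) => s s0; rewrite rec//.
  have := H1 s s0; rewrite ler_norml => /andP[h1 h1'].
  have := H2 s s0; rewrite ler_norml => /andP[h2 h2'].
  have hC := HC _ (normr_ge0 (mu s - nu s)).
  have hb : b * (mu s - nu s) <= b * `|mu s - nu s|.
    by rewrite ler_wpM2l// ler_norm.
  have hb' : b * ((p - q - 2 * e) * s - (C1 + C2)) <= b * (mu s - nu s).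
    by rewrite ler_wpM2l//; lra.
  (* As [q <= p], both [mu] and [nu] lie above the line of slope [q - e], up to a constant. *)
  have hmin : (q - e) * s - (`|C1| + `|C2|) <= Num.min (mu s) (nu s).
    have := ler_norm C1; have := ler_norm C2.
    have := normr_ge0 C1; have := normr_ge0 C2 => *.
    have : 0 <= (p - q) * s by rewrite mulr_ge0 ?subr_ge0.
    by move=> *; rewrite le_min; apply/andP; split; lra.
  lra.
have Sn : (S !=set0) by exists 0.
have c0 : 0 <= sup S by apply: ub_le_sup => //; exists 1.
have c1 : sup S <= 1 by apply: ge_sup.
suff kc : q / (1 - p + q) <= sup S.
  move=> a ak; have [b [b0 [C HC]] ab] := sup_gt Sn (lt_le_trans ak kc).
  exists C => s s0; have := HC s s0.
  have : 0 <= (b - a) * s by apply: mulr_ge0 => //; lra.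
  lra.
case: leP => //; rewrite ltr_pdivlMr// => ck; exfalso.
have [d dE] : exists d, d = q - sup S * (1 - p + q).
  by exists (q - sup S * (1 - p + q)).
have d0 : 0 < d by rewrite dE; lra.
(* With [d / 5] as slack for [b] and as error, the step loses at most [((p - q) + 1 + 2 * b) * d / 5
   <= 4 * d / 5] of the gain [d], so its slope exceeds [sup S]. *)
have [b Sb bc] : exists2 b, S b & sup S - d / 5 < b by apply: sup_gt => //; lra.
have bc' : b <= sup S by apply: ub_le_sup => //; exists 1.
have T : sup S < q - d / 5 + b * (p - q - 2 * (d / 5)).
  have : 0 <= (b - (sup S - d / 5)) * (p - q) by apply: mulr_ge0; lra.
  have : 0 <= (1 - b) * d by apply: mulr_ge0; lra.
  have : 0 <= d * (1 - (p - q)) by apply: mulr_ge0; lra.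
  lra.
have : q - d / 5 + b * (p - q - 2 * (d / 5)) <= sup S.
  apply: ub_le_sup; first by exists 1.
  by apply: Sstep => //; lra.
lra.
Qed.

(** The same contraction acts on slopes of linear upper bounds: were their infimum above the fixed
    point, one step would go below it. *)
Lemma growth_recursion_le (R : realType) (phi mu nu : R -> R) (p q : R) :
  (forall s, 0 <= s -> 0 <= phi s <= s) ->
  (forall s, 0 <= s ->
    phi s = Num.min (mu s) (nu s) + phi `|mu s - nu s|) ->
  growth mu p -> growth nu q -> p <= 1 -> 0 <= q -> q <= p -> 0 < 1 - p + q ->
  growth_ge (fun s => - phi s) (- (q / (1 - p + q))).
Proof.
move=> hphi rec gmu gnu p1 q0 qp pq.
pose S := [set b | 0 <= b /\ exists C, forall s, 0 <= s -> phi s <= b * s + C].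
have S1 : S 1.
  split=> //; exists 0 => s s0; have /andP[] := hphi s s0; lra.
have Slb : lbound S 0 by move=> b [].
have Sstep b e : S b -> 0 < e -> S (q + e + b * (p - q + 2 * e)).
  move=> [b0 [C HC]] e0; split.
    by apply: addr_ge0; [lra|apply: mulr_ge0 => //; lra].
  have [C1 H1] := growthP _ _ _ gmu e e0.
  have [C2 H2] := growthP _ _ _ gnu e e0.
  exists (C2 + b * (C1 + C2) + C) => s s0; rewrite rec//.
  have := H1 s s0; rewrite ler_norml => /andP[h1 h1'].
  have := H2 s s0; rewrite ler_norml => /andP[h2 h2'].
  have hC := HC _ (normr_ge0 (mu s - nu s)).
  have hb : b * `|mu s - nu s| <= b * ((p - q + 2 * e) * s + (C1 + C2)).
    rewrite ler_wpM2l// ler_norml.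
    (* This also controls [nu s - mu s], whose slope [q - p] is at most [p - q]. *)
    have : 0 <= (p - q) * s by rewrite mulr_ge0 ?subr_ge0.
    by move=> *; apply/andP; split; lra.
  have hmin : Num.min (mu s) (nu s) <= (q + e) * s + C2.
    by rewrite ge_min; apply/orP; right; lra.
  lra.
have Sn : (S !=set0) by exists 1.
have hlb : has_lbound S by exists 0.
have c0 : 0 <= inf S by apply: lb_le_inf.
have c1 : inf S <= 1 by apply: ge_inf.
suff kc : inf S <= q / (1 - p + q).
  move=> a ak; have [|b [b0 [C HC]] ab] := @inf_lt _ S (- a) Sn; first lra.
  exists C => s s0; have := HC s s0.
  have : 0 <= (- a - b) * s by apply: mulr_ge0 => //; lra.
  lra.
case: leP => //; rewrite ltr_pdivrMr// => ck; exfalso.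
have [d dE] : exists d, d = inf S * (1 - p + q) - q.
  by exists (inf S * (1 - p + q) - q).
have d0 : 0 < d by rewrite dE; lra.
(* This keeps the slope [b] chosen next below [2]. *)
have d1 : d <= 1.
  have : 0 <= (1 - inf S) * (1 - p + q) by apply: mulr_ge0; lra.
  rewrite dE; lra.
(* The step loses at most [((p - q) + 1 + 2 * b) * d / 8 <= 6 * d / 8], using [b <= 2]. *)
have [b Sb bc] : exists2 b, S b & b < inf S + d / 8 by apply: inf_lt => //; lra.
have bc' : inf S <= b by apply: ge_inf.
have T : q + d / 8 + b * (p - q + 2 * (d / 8)) < inf S.
  have : 0 <= (inf S + d / 8 - b) * (p - q) by apply: mulr_ge0; lra.
  have : 0 <= (2 - b) * d by apply: mulr_ge0; lra.
  have : 0 <= d * (1 - (p - q)) by apply: mulr_ge0; lra.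
  lra.
have : inf S <= q + d / 8 + b * (p - q + 2 * (d / 8)).
  by apply: ge_inf => //; apply: Sstep => //; lra.
lra.
Qed.

(** * Orders of means and the invariance equation *)

(** Growth determines both suprema; conversely, each supremum is itself a growth slope because
    [|neglog M s| <= s]. *)
Lemma growth_neglogP (R : realType) (M : R -> R -> R) (k : R) : HS M ->
  growth (neglog M) k <-> lord M = k /\ uord M = k.
Proof.
move=> [hM _ _]; rewrite lordE// uordE//.
have hb s : 0 <= s -> `|neglog M s| <= s.
  by move=> s0; have /andP[h1 h2] := neglog_bounds hM s s0; rewrite ger0_norm.
have hbN s : 0 <= s -> `|- neglog M s| <= s by rewrite normrN; exact: hb.
split.
  move=> g; split; first exact: sup_dominated_slopes.
  rewrite (@sup_dominated_slopes _ _ (- k)) ?opprK//.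
  split; first exact: g.2.
  rewrite opprK (_ : (fun s => - - _) = neglog M); first exact: g.1.
  by apply: funext => s; rewrite opprK.
move=> [<- h]; split; first exact: growth_ge_sup.
by rewrite -h opprK; exact: growth_ge_sup.
Qed.

(* Homogeneity comes from uniqueness: [K (t x, t y) / t] is again an invariant
   mean. *)
Lemma invariant_mean_HS (R : realType) (M N K : R -> R -> R) :
  HS M -> HS N -> unique_invariant_mean M N K -> HS K.
Proof.
move=> [mM sM hM] [mN sN hN] [[mK iK] uK]; split=> //.
  (* [M] and [N] take the same values at [(x, y)] and [(y, x)], hence so does [K] by invariance. *)
  by move=> x y x0 y0; rewrite -iK// sM// sN// iK.
move=> x y t x0 y0 t0.
have := uK (fun x y => t^-1 * K (t * x) (t * y)).
move=> /(_ _ x y x0 y0) <-; first by rewrite mulrA divff ?gt_eqF// mul1r.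
split=> u v u0 v0.
  have [] := mK (t * u) (t * v) (mulr_gt0 t0 u0) (mulr_gt0 t0 v0).
  rewrite -(minr_pMr _ _ (ltW t0)) -(maxr_pMr _ _ (ltW t0)).
  by rewrite ![t^-1 * _]mulrC ler_pdivlMr// ler_pdivrMr// ![_ * t]mulrC.
by rewrite -hM// -hN// iK// mulr_gt0.
Qed.

Lemma neglog_invariant (R : realType) (M N K : R -> R -> R) :
  is_mean M -> is_mean N -> HS K -> Defs.invariant M N K ->
  forall s, neglog K s = Num.min (neglog M s) (neglog N s)
    + neglog K `|neglog M s - neglog N s|.
Proof.
move=> mM mN [mK sK hK] iK s.
(* Homogeneity factors out the larger argument [expR (- u)]; its exponent [u] becomes the minimum in
   the recursion. *)
have Kexp u v : u <= v ->
    K (expR (- v)) (expR (- u)) = expR (- (u + neglog K (v - u))).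
  move=> uv; rewrite opprD expRD -(expRN_neglog mK).
  rewrite -hK ?expR_gt0// mulr1 -expRD; congr (K (expR _) _); ring.
apply: oppr_inj; apply: expR_inj; rewrite -(expRN_neglog mK) -iK ?expR_gt0//.
rewrite (expRN_neglog mM) (expRN_neglog mN).
case: (leP (neglog M s) (neglog N s)) => h.
  by rewrite sK ?expR_gt0// Kexp// distrC ger0_norm// subr_ge0.
by rewrite Kexp ?ltW// gtr0_norm// subr_gt0.
Qed.

Theorem corollary3p5 (R : realType) (M N K : R -> R -> R)
  (hM : GPG M) (hN : GPG N)
  (hord : ordstar M >= ordstar N)
  (hne : (ordstar M, ordstar N) <> (1, 0))
  (hK : unique_invariant_mean M N K) :
  GPG K /\ ordstar K = ordstar N / (1 - ordstar M + ordstar N).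
Proof.
have [HM eM] := hM; have [HN eN] := hN.
have HK := invariant_mean_HS _ _ _ _ HM HN hK.
have [[mK iK] _] := hK.
have [mM _ _] := HM; have [mN _ _] := HN.
have gM : growth (neglog M) (ordstar M) by apply/growth_neglogP.
have gN : growth (neglog N) (ordstar N) by apply/growth_neglogP.
have /andP[p0 p1] := growth_itv _ _ _ (neglog_bounds mM) gM.
have /andP[q0 q1] := growth_itv _ _ _ (neglog_bounds mN) gN.
(* Both orders lie in [[0, 1]], so the denominator vanishes only at the excluded pair [(1, 0)]. *)
have pq : 0 < 1 - ordstar M + ordstar N.
  rewrite lt_neqAle; apply/andP; split; last lra.
  by apply/eqP => h; apply: hne; congr pair; lra.
have rec s (_ : 0 <= s) := neglog_invariant _ _ _ _ mM mN HK iK s.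
have /growth_neglogP[//|lK uK] :
    growth (neglog K) (ordstar N / (1 - ordstar M + ordstar N)).
  split.
    exact: growth_recursion_ge (neglog_bounds mK) rec gM gN _ _ _ _.
  exact: growth_recursion_le (neglog_bounds mK) rec gM gN _ _ _ _.
by split=> //; split=> //; rewrite lK uK.
Qed.
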